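(* There is a constant $c>0$ such that for any $i,j,\ell \in \mathbb{N}$ with $\ell \leq ij - i -j$ and $\frac{1}{2}\leq \frac{i}{j}\leq 2$, \[ C(i,j,\ell)\leq i^{j}j^{i}(i+j)^{\frac{3\ell-1}{2}}\left(\frac{c}{\ell}\right)^{\frac{\ell}{2}}. \]
   Context: $\mathbb{N}$ is the set of positive integers. For $i,j\in\mathbb{N}$ and $\ell\in\mathbb{Z}$, $C(i,j,\ell)$ denotes the number of connected bipartite graphs on labelled vertices with $i$ vertices in one (given) partition class, $j$ vertices in the second (given) partition class, and $i+j+\ell$ edges. *)

(* Defs.v *)
From HB Require Import structures.
From mathcomp Require Import all_boot all_order all_algebra.
Set Implicit Arguments.
Unset Strict Implicit.
Unset Printing Implicit Defensive.
Import Order.TTheory GRing.Theory Num.Theory.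

(* A bipartite graph with given classes 'I_i and 'I_j is encoded by its edge
   set E; its vertex set is the disjoint union 'I_i + 'I_j. *)
Definition bip_adj (i j : nat) (E : {set 'I_i * 'I_j}) : rel ('I_i + 'I_j) :=
  fun x y => match x, y with
             | inl a, inr b => (a, b) \in E
             | inr b, inl a => (a, b) \in E
             | _, _ => false
             end.

Definition bip_connected (i j : nat) (E : {set 'I_i * 'I_j}) : bool :=
  [forall x, forall y, connect (bip_adj E) x y].

Definition conn_bip_graphs (i j : nat) (l : int) : {set {set 'I_i * 'I_j}} :=
  [set E : {set 'I_i * 'I_j} |
    bip_connected E && (#|E|%:Z == i%:Z + j%:Z + l)%R].

Definition C (i j : nat) (l : int) : nat := #|conn_bip_graphs i j l|.

(* Main.v *)
Require Import Defs.
From HB Require Import structures.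
From mathcomp Require Import all_boot all_order all_algebra.
From mathcomp Require Import all_classical all_reals all_analysis.
From mathcomp Require Import ring lra.
Set Implicit Arguments.
Unset Strict Implicit.
Unset Printing Implicit Defensive.
Import Order.TTheory GRing.Theory Num.Theory.

(* A connected graph has a normal (depth-first) spanning tree, all of whose
   non-tree edges join a vertex to one of its ancestors. So with n = i + j and
   k = l + 1, C(i, j, l) is at most the sum over the spanning trees f of K_{i,j}
   of binomial(D f, k), where D f is the sum of the depths of all vertices, and
   binomial(D f, k) x^k <= exp(x D f) <= the mean over v of exp(n x depth(v)).
   The number of pairs (spanning tree, vertex v) with depth(v) >= d is computed
   by fixing the first d steps of the path from the root to v; it has Gaussian
   tails of width sqrt n. Hence the sum is at most
   2 i^(j-1) j^(i-1) exp(4k) x^(-k) for x = (k / n^3)^(1/2), and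
   n^2 <= 9/2 i j when 1/2 <= i/j <= 2. *)

(** * Rooted forests *)

Lemma fconnectP (T : finType) (f : T -> T) x y :
  reflect (exists n, iter n f x = y) (fconnect f x y).
Proof.
apply: (iffP idP) => [/iter_findex <-|[n <-]]; first by eexists.
exact: fconnect_iter.
Qed.

Lemma fconnect_step (T : finType) (f : T -> T) x y :
  fconnect f x y = (x == y) || fconnect f (f x) y.
Proof.
apply/idP/orP => [/fconnectP[[|n] /= <-]|[/eqP->|xy]]; first by left.
- by right; rewrite -iterS iterSr fconnect_iter.
- exact: connect0.
- exact: connect_trans (fconnect1 f x) xy.
Qed.

Section Cut.
Variables (T : finType) (f g : T -> T) (u : T).
Hypothesis fg : forall v, v != u -> g v = f v.

Lemma fconnect_cut v w : ~~ fconnect f v u -> fconnect g v w = fconnect f v w.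
Proof.
move=> vu; have E n : iter n g v = iter n f v.
  elim: n => //= n ->; apply: fg; apply: contraNneq vu => <-.
  exact: fconnect_iter.
by apply/fconnectP/fconnectP => -[n]; [rewrite E|rewrite -E]; exists n.
Qed.

Lemma fconnect_cutr v : fconnect f v u -> fconnect g v u.
Proof.
case/fconnectP=> n; elim: n v => [|n IHn] v; first by move=> /= <-; apply: connect0.
rewrite iterSr => /IHn gu; rewrite fconnect_step.
by have [//|/fg ->] := eqVneq v u.
Qed.
End Cut.

Section Forest.
Variables (V : finType) (kappa : V -> bool).
Implicit Types (S : {set V}) (f g : {ffun V -> V}) (u v w s : V).

(* A forest is encoded by its parent map, whose fixed points are the roots [S]. *)
Definition forest (S : {set V}) (f : {ffun V -> V}) :=
  [forall v, if v \in S then f v == v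
             else (kappa (f v) != kappa v) && [exists s in S, fconnect f v s]].

Lemma forest_root S f s : forest S f -> s \in S -> f s = s.
Proof. by move=> /forallP/(_ s) + sS; rewrite sS => /eqP. Qed.

Lemma forest_color S f v : forest S f -> v \notin S -> kappa (f v) = ~~ kappa v.
Proof.
move=> /forallP/(_ v) + vS; rewrite (negPf vS) => /andP[+ _].
by case: (kappa v) (kappa _) => [] [].
Qed.

Lemma forest_reach S f v : forest S f -> exists2 s, s \in S & fconnect f v s.
Proof.
move=> fS; have [vS|vS] := boolP (v \in S); first by exists v; rewrite ?connect0.
by move/forallP/(_ v): fS; rewrite (negPf vS) => /andP[_ /exists_inP].
Qed.

Lemma forestP S (f : {ffun V -> V}) :
  (forall s, s \in S -> f s = s) ->
  (forall v, v \notin S -> kappa (f v) = ~~ kappa v) ->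
  (forall v, v \notin S -> exists2 s, s \in S & fconnect f v s) -> forest S f.
Proof.
move=> fr fc fs; apply/forallP=> v; have [/fr->//|vS] := boolP (v \in S).
rewrite fc //; apply/andP; split; first by case: (kappa v).
by apply/exists_inP/fs.
Qed.

Lemma fix_iter (f : V -> V) n s : f s = s -> iter n f s = s.
Proof. by move=> fs; elim: n => //= n ->. Qed.

Lemma fix_connect (f : V -> V) s w : f s = s -> fconnect f s w = (s == w).
Proof.
by move=> fs; apply/fconnectP/eqP => [[n <-]|->]; [rewrite fix_iter|exists 0].
Qed.

Lemma forest_ind S f (P : V -> Prop) : forest S f ->
  (forall s, s \in S -> P s) ->
  (forall v, v \notin S -> P (f v) -> P v) -> forall v, P v.
Proof.
move=> fS P0 P1 v; have [s sS /fconnectP[n]] := forest_reach v fS.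
elim: n v => [|n IHn] v /=; first by move=> ->; apply: P0.
rewrite -iterS iterSr => /IHn Pfv.
by have [/P0//|/P1] := boolP (v \in S); apply.
Qed.

Lemma forest_acyclic S f v : forest S f -> v \notin S -> ~~ fconnect f (f v) v.
Proof.
move=> fS vS; apply/negP=> /fconnectP[t]; rewrite -iterSr => tv.
have [s sS /fconnectP[k ks]] := forest_reach v fS.
have E q : iter (q * t.+1) f v = v by elim: q => // q IHq; rewrite mulSn iterD IHq.
(* After [k] periods the orbit of [v] is back at [v], but it has been stuck at the fixed point [s]
   since step [k]; hence [v = s]. *)
have := E k; rewrite mulnS addnC iterD ks fix_iter; last exact: forest_root fS sS.
by move=> sv; rewrite -sv sS in vS.
Qed.

Lemma forest_anti S f v w : forest S f -> fconnect f v w -> fconnect f w v -> v = w.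
Proof.
move=> fS; rewrite fconnect_step => /orP[/eqP//|fvw wv].
have [vS|vS] := boolP (v \in S).
  by move: fvw; rewrite (forest_root fS vS) fix_connect ?(forest_root fS) // => /eqP.
by have /negP[] := forest_acyclic fS vS; apply: connect_trans fvw wv.
Qed.

Lemma order_root (f : V -> V) (s : V) : f s = s -> order f s = 1.
Proof.
by move=> fs; rewrite /order (@eq_card _ _ (pred1 s)) ?card1 // => w;
  rewrite !inE fix_connect // eq_sym.
Qed.

(** By acyclicity [v] is not one of its proper ancestors. Thus [order f v] is the depth of [v] plus
    one. *)
Lemma order_step S f v : forest S f -> v \notin S ->
  order f v = (order f (f v)).+1.
Proof.
move=> fS vS; rewrite /order (cardD1 v) !inE connect0 add1n; congr _.+1.
apply: eq_card => w; rewrite !inE [in LHS]fconnect_step eq_sym.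
by have [<-|//] := eqVneq v w; rewrite (negPf (forest_acyclic fS vS)).
Qed.

Lemma forest_parity S f v s : forest S f -> s \in S -> fconnect f v s ->
  kappa v = kappa s (+) odd (order f v).-1.
Proof.
move=> fS sS; move: v; apply: (forest_ind fS) => [t tS|v vS IHv].
  have ft := forest_root fS tS.
  by rewrite fix_connect // order_root // addbF => /eqP->.
rewrite fconnect_step => /orP[/eqP vs|/IHv]; first by rewrite vs sS in vS.
rewrite (forest_color fS vS) (order_step fS vS) /= -[order f (f v)]orderSpred /=.
by rewrite addbN => <-; rewrite negbK.
Qed.

Definition cut (f : {ffun V -> V}) u : {ffun V -> V} :=
  [ffun v => if v == u then u else f v].

Lemma cutE f u v : v != u -> cut f u v = f v.
Proof. by rewrite ffunE => /negPf->. Qed.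

Lemma cut_inj f g u : cut f u = cut g u -> f u = g u -> f = g.
Proof.
move=> /ffunP fg fgu; apply/ffunP=> v; have := fg v; rewrite !ffunE.
by case: eqP => [->|].
Qed.

Lemma forest_cut S f u : forest S f -> u \notin S -> forest (u |: S) (cut f u).
Proof.
move=> fS uS; apply: forestP => v; rewrite in_setU1.
- by case/orP=> [/eqP->|vS]; rewrite ffunE ?eqxx // (forest_root fS) //; case: eqP.
- by rewrite negb_or => /andP[/cutE-> /(forest_color fS)].
rewrite negb_or => /andP[vu vS]; have [vtu|vtu] := boolP (fconnect f v u).
  by exists u; rewrite ?setU11 // (fconnect_cutr (@cutE f u)).
have [s sS vs] := forest_reach v fS.
by exists s; rewrite ?setU1r // (fconnect_cut (@cutE f u)).
Qed.

(** * Counting forests with a marked deep vertex *)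

Definition color_class b : {set V} := [set v | kappa v == b].

(* Prescribing the parity of the depth keeps the bounds sharp: [deep S s 0] has
   as many elements as there are colour-swapping parent maps, acyclic or not. *)
Definition deep S s d : {set {ffun V -> V} * V} :=
  [set p | [&& forest S p.1, fconnect p.1 p.2 s,
              kappa p.2 == kappa s (+) odd d & d < order p.1 p.2]].

(* Cutting the edge from [u] to its parent [w] makes [u] a root. If the marked
   vertex [v] was below [u], the two trees hold [w] and [v] the other way round;
   as [w] and [v] have the same colour, swapping their roles gives an injection. *)
Lemma deep0_cut S s u : s \in S -> u \notin S -> kappa u != kappa s ->
  #|deep S s 0| <= #|deep (u |: S) s 0| * #|color_class (kappa s)|.
Proof.
move=> sS uS kus.
have kfu f : forest S f -> kappa (f u) = kappa s.
  move=> fS; rewrite (forest_color fS uS).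
  by case: (kappa u) (kappa s) kus => [] [].
have order0 (f : V -> V) v : 0 < order f v by rewrite -orderSpred.
pose phi (p : {ffun V -> V} * V) := let: (f, v) := p in
  if fconnect f v u then ((cut f u, f u), v) else ((cut f u, v), f u).
rewrite -cardsX -(@card_in_imset _ _ phi).
  apply/subset_leq_card/fintype.subsetP => _ /imsetP[[f v] + ->].
  rewrite inE /= addbF => /and4P[fS vs /eqP kv _].
  have cf := forest_cut fS uS; have cE := @cutE f u.
  have nfu := forest_acyclic fS uS.
  rewrite /phi; case: ifPn => vu; rewrite !inE /= cf addbF ?kv ?kfu ?eqxx ?order0 ?andbT //=.
    rewrite (fconnect_cut cE) //.
    (* Since [u] is on the path from [v] to [s], its parent also reaches [s]. *)
    move: vs; case/fconnectP: vu => n; elim: n v {kv} => [|n IHn] v /=.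
      move=> ->; rewrite fconnect_step => /orP[/eqP us|//].
      by rewrite us sS in uS.
    rewrite -iterS iterSr => /IHn + vs; apply.
    move: vs; rewrite fconnect_step => /orP[/eqP ->|//].
    by rewrite (forest_root fS sS) connect0.
  by rewrite (fconnect_cut cE).
move=> [f v] [g w]; rewrite !inE /= => /and4P[fS vs _ _] /and4P[gS ws _ _].
have cE h := @cutE h u.
rewrite /phi; case: ifPn => vu; case: ifPn => wu [fg].
- by move=> fgu ->; rewrite (cut_inj fg fgu).
(* In the mixed cases, equal images make the marked vertex of one pair the parent of [u] in the
   other forest. It reaches [u] in the common cut forest, against acyclicity. *)
- move=> fuw vgu; have := fconnect_cutr (cE f) vu.
  by rewrite fg vgu (fconnect_cut (cE g)) ?(negPf (forest_acyclic gS uS)).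
- move=> vgu fuw; have := fconnect_cutr (cE g) wu.
  by rewrite -fg -fuw (fconnect_cut (cE f)) ?(negPf (forest_acyclic fS uS)).
- by move=> -> fgu; rewrite (cut_inj fg fgu).
Qed.

Lemma card_swaps S :
  #|[set f : {ffun V -> V} | [forall v, if v \in S then f v == v
                                        else kappa (f v) == ~~ kappa v]]|
  = #|color_class true| ^ #|color_class false :\: S|
    * #|color_class false| ^ #|color_class true :\: S|.
Proof.
pose F v : {pred V} := [pred w | if v \in S then w == v else kappa w == ~~ kappa v].
rewrite (@eq_card _ _ (family F)); last first.
  by move=> f; rewrite inE; apply/forallP/familyP => fP v; have := fP v.
rewrite card_family foldrE big_map big_enum /=.
rewrite (eq_bigr (fun v => (if v \in color_class false :\: S then #|color_class true| else 1)
    * (if v \in color_class true :\: S then #|color_class false| else 1))); last first.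
  move=> v _; rewrite !inE; have [vS|vS] /= := boolP (v \in S).
    by rewrite muln1; apply: etrans (card1 v); apply: eq_card => w; rewrite !inE vS.
  case kv: (kappa v) => /=; rewrite ?muln1 ?mul1n; apply: eq_card => w;
  by rewrite !inE (negPf vS) kv.
by rewrite big_split /= -!big_mkcond !prod_nat_const.
Qed.

Lemma card_forest S b :
  #|[set f | forest S f]| <=
  #|color_class b| ^ #|color_class (~~ b) :\: S|
  * #|color_class (~~ b)| ^ #|color_class b :\: S|.
Proof.
have -> : #|color_class b| ^ #|color_class (~~ b) :\: S|
  * #|color_class (~~ b)| ^ #|color_class b :\: S| =
  #|color_class true| ^ #|color_class false :\: S|
    * #|color_class false| ^ #|color_class true :\: S|.
  by case: b => //=; rewrite mulnC.
rewrite -card_swaps; apply/subset_leq_card/fintype.subsetP => f; rewrite !inE => fS.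
apply/forallP=> v; case: ifPn => [/(forest_root fS)->//|].
by move=> /(forest_color fS)->.
Qed.

(** Induction on the number of non-roots coloured unlike [s]: [deep0_cut] turns one into a root at
    the cost of one factor. When none is left, the parent of a non-root is a root of the other
    colour, so the mark can only be [s] and just the forests are counted. *)
Lemma card_deep0 S s : s \in S ->
  #|deep S s 0| <=
  #|color_class (kappa s)| ^ #|color_class (~~ kappa s) :\: S|
  * #|color_class (~~ kappa s)| ^ #|color_class (kappa s) :\: S|.
Proof.
move En: #|_ :\: S| => n; elim: n S En => [|n IHn] S En sS.
  rewrite -[X in _ ^ X * _]En; apply: leq_trans (card_forest S (kappa s)).
  have S0 v : v \notin S -> kappa v = kappa s.
    move=> vS; apply/eqP; move/eqP: En; rewrite cards_eq0 => /eqP/setP/(_ v).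
    by rewrite !inE vS /=; case: (kappa v) (kappa s) => [] [].
  rewrite -(@card_in_imset _ _ fst).
    apply/subset_leq_card/fintype.subsetP => _ /imsetP[[f v] + ->].
    by rewrite !inE => /andP[].
  have vs f v : (f, v) \in deep S s 0 -> v = s.
    rewrite inE /= addbF => /and4P[fS + /eqP kv _].
    have [vS|vS] := boolP (v \in S).
      by rewrite fix_connect ?(forest_root fS) // => /eqP.
    have kfv := forest_color fS vS.
    have fvS : f v \in S by apply: contraPT kfv => /S0 ->; rewrite kv; case: (kappa s).
    rewrite fconnect_step fix_connect ?(forest_root fS fvS) //.
    by case/orP=> /eqP // fvs; move: kfv; rewrite fvs kv; case: (kappa s).
  by move=> [f v] [g w] fv gw /= ->; rewrite (vs _ _ fv) (vs _ _ gw).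
have : 0 < #|color_class (~~ kappa s) :\: S| by rewrite En.
case/card_gt0P=> u; rewrite !inE => /andP[uS /eqP ku].
have kus : kappa u != kappa s by rewrite ku; case: (kappa s).
apply: leq_trans (deep0_cut sS uS kus) _.
have <- : color_class (kappa s) :\: (u |: S) = color_class (kappa s) :\: S.
  apply/setP=> w; rewrite !inE negb_or -andbA.
  by have [->|//] := eqVneq w u; rewrite (negPf kus) andbF.
rewrite expnSr mulnAC leq_mul2r IHn ?orbT ?setU1r //.
apply/succn_inj; rewrite -En (cardsD1 u (_ :\: S)) !inE uS ku eqxx /= add1n.
by congr _.+1; apply: eq_card => w; rewrite !inE negb_or andbA.
Qed.

Lemma order_cut S f z s v : forest S f -> s \in S -> z \notin S -> f z = s ->
  fconnect f v z -> order f v = (order (cut f z) v).+1.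
Proof.
move=> fS sS zS fz; have cf := forest_cut fS zS.
move: v; apply: (forest_ind fS) => [t tS|v vS IHv].
  by rewrite fix_connect ?(forest_root fS) // => /eqP tz; rewrite -tz tS in zS.
have [-> _|vz] := eqVneq v z.
  rewrite (order_step fS zS) fz order_root ?(forest_root fS) //.
  by rewrite order_root // ffunE eqxx.
rewrite fconnect_step (negPf vz) /= => /IHv; rewrite (order_step fS vS) => ->.
by rewrite (order_step cf (v := v)) ?in_setU1 ?negb_or ?vz // cutE.
Qed.

Lemma exists_top S f s v : forest S f -> s \in S -> fconnect f v s -> v != s ->
  exists z, [/\ z \notin S, f z = s & fconnect f v z].
Proof.
move=> fS sS; move: v; apply: (forest_ind fS) => [t tS|v vS IHv].
  by rewrite fix_connect ?(forest_root fS) // => ->.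
rewrite fconnect_step => + vs; rewrite (negPf vs) /=.
have [fvs _|fvs /IHv[//|z [zS fz vz]]] := eqVneq (f v) s.
  by exists v; rewrite connect0.
by exists z; split=> //; rewrite fconnect_step vz orbT.
Qed.

(** Classify by the child [z] of [s] on the path from the marked vertex. Cutting [z] off lowers the
    depth by one and loses nothing, as the parent of [z] is known to be [s]. *)
Lemma deepS_top S s d : s \in S ->
  #|deep S s d.+1| <=
  \sum_(z in color_class (~~ kappa s) :\: S) #|deep (z |: S) z d|.
Proof.
move=> sS; pose X z := [set p in deep S s d.+1 | (p.1 z == s) && fconnect p.1 p.2 z].
apply: (@leq_trans #|\bigcup_(z in color_class (~~ kappa s) :\: S) X z|).
  apply/subset_leq_card/fintype.subsetP => -[f v] fvd; move: (fvd).
  rewrite inE /= => /and4P[fS vs kv dv].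
  have [|z [zS fz vz]] := exists_top fS sS vs.
    apply: contraTneq dv => ->; rewrite order_root //.
    exact: forest_root fS sS.
  apply/finset.bigcupP; exists z; last by rewrite inE fvd /= fz eqxx.
  by rewrite !inE zS /= -fz (forest_color fS zS) negbK.
apply: (@leq_trans (\sum_(z in color_class (~~ kappa s) :\: S) #|X z|)).
  elim/big_rec2: _ => [|z n A _ An]; first by rewrite cards0.
  by apply: leq_trans (leq_card_setU _ _) _; rewrite leq_add2l.
apply: leq_sum => z; rewrite !inE => /andP[zS /eqP kz].
rewrite -(@card_in_imset _ _ (fun p => (cut p.1 z, p.2))).
  apply/subset_leq_card/fintype.subsetP => _ /imsetP[[f v] + ->].
  rewrite !inE /= => /andP[/and4P[fS vs kv dv] /andP[/eqP fz vz]].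
  rewrite (forest_cut fS zS) (fconnect_cutr (@cutE f z) vz) /=.
  by rewrite kz (eqP kv) addNb addbN eqxx -ltnS -(order_cut fS sS zS fz vz).
move=> [f v] [g w]; rewrite !inE /= => /andP[_ /andP[/eqP fz _]] /andP[_ /andP[/eqP gz _]].
by move=> [fg ->]; rewrite (cut_inj fg) // fz gz.
Qed.

(* [deep_count d p q n m] bounds [deep S s d] when [p] (resp. [q]) vertices of
   the colour opposite (resp. equal) to that of [s] lie outside [S], and the
   colour class of [s] (resp. the other one) has [n] (resp. [m]) elements. *)
Fixpoint deep_count d p q n m :=
  if d is d'.+1 then p * deep_count d' q p.-1 m n else n ^ p * m ^ q.

(** Each application of [deepS_top] moves to a root of the other colour, so the two classes swap
    roles and one vertex is used up; [card_deep0] ends the recursion. *)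
Lemma card_deep S s d : s \in S ->
  #|deep S s d| <=
  deep_count d #|color_class (~~ kappa s) :\: S| #|color_class (kappa s) :\: S|
    #|color_class (kappa s)| #|color_class (~~ kappa s)|.
Proof.
elim: d S s => [|d IHd] S s sS; first exact: card_deep0.
apply: leq_trans (deepS_top d sS) _.
rewrite [deep_count _ _ _ _ _]/= -sum_nat_const; apply: leq_sum => z zS.
have := zS; rewrite !inE => /andP[nzS /eqP kz].
apply: leq_trans (IHd _ _ (setU11 z S)) _; rewrite kz negbK.
have -> : color_class (~~ kappa s) :\: (z |: S) = (color_class (~~ kappa s) :\: S) :\ z.
  by apply/setP=> w; rewrite !inE negb_or andbA.
have -> : color_class (kappa s) :\: (z |: S) = color_class (kappa s) :\: S.
  apply/setP=> w; rewrite !inE negb_or -andbA.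
  by have [->|//] := eqVneq w z; rewrite kz; case: (kappa s); rewrite ?andbF.
by rewrite [X in deep_count _ _ X.-1](cardsD1 z) zS.
Qed.

(** Two levels restore the roles of the classes. The falling factorials count the choices, in each
    class, of the last [e.*2] vertices before the root. *)
Lemma deep_count_double e p q n m :
  deep_count e.*2 p q n m = p ^_ e * q ^_ e * n ^ (p - e) * m ^ (q - e).
Proof.
elim: e p q => [|e IHe] p q; first by rewrite !ffactn0 !subn0 !mul1n.
rewrite doubleS /= !ffactnS; case: p q => [|p] [|q] //=; rewrite ?mul0n ?muln0 //.
rewrite IHe !subSS !mulnA; congr (_ * _ * _); rewrite -!mulnA; congr (_ * _).
by rewrite mulnCA.
Qed.

(** The parity of the depth, which [forest_parity] reads off the colour, decides which of the two
    sets contains a pair. *)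
Lemma card_depth_ge (r : V) e :
  #|[set p : {ffun V -> V} * V | forest [set r] p.1 & e <= (order p.1 p.2).-1./2]|
  <= #|deep [set r] r e.*2| + #|deep [set r] r e.*2.+1|.
Proof.
apply: leq_trans (leq_card_setU _ _); apply/subset_leq_card/fintype.subsetP=> -[f v].
rewrite !inE geq_half_double /= => /andP[fS de]; rewrite fS /=.
have [s /set1P-> vr] := forest_reach v fS; rewrite vr /= odd_double.
rewrite (forest_parity fS (set11 r) vr) -[order f v]orderSpred /= !ltnS de.
move: de; rewrite leq_eqVlt => /orP[/eqP <-|->]; first by rewrite odd_double eqxx.
by case: (kappa r) (odd _) => [] [].
Qed.

End Forest.

(** * Normal spanning trees *)

Section NormalTree.
Variables (V : finType) (kappa : V -> bool) (r : V) (e : rel V).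
Hypothesis e_sym : symmetric e.
Hypothesis e_proper : forall u v, e u v -> kappa u = ~~ kappa v.
Hypothesis e_conn : forall v, connect e v r.
Implicit Types (f : {ffun V -> V}) (u v w : V).

Definition spanning f := forest kappa [set r] f && [forall v, (v != r) ==> e v (f v)].

Definition normal f :=
  spanning f && [forall u, forall v, e u v ==> fconnect f u v || fconnect f v u].

(** Breadth-first tree: the parent of [v] is a neighbour at smaller distance from [r], so induction
    on the distance reaches [r]. *)
Lemma exists_spanning : exists f, spanning f.
Proof.
pose walk v n := [exists t : n.-tuple V, path e v t && (last v t == r)].
have walkP v : exists n, walk v n.
  have /connectP[p pv pr] := e_conn v.
  by exists (size p); apply/existsP; exists (in_tuple p); rewrite pv -pr eqxx.
pose dist v := ex_minn (walkP v).
have closer v : v != r -> exists u, e v u && (dist u < dist v).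
  move=> vr; rewrite {2}/dist; case: ex_minnP => n /existsP[[p np]] /= /andP[].
  case: p np => [|x p] /= np.
    by move=> _ /eqP vr'; rewrite vr' eqxx in vr.
  case/andP=> evx px pr _; exists x; rewrite evx /= -(eqP np) ltnS /dist.
  case: ex_minnP => m _; apply; apply/existsP; exists (in_tuple p).
  by rewrite px pr.
pose f := [ffun v => if v == r then r else odflt r [pick u | e v u && (dist u < dist v)]].
have fr : f r = r by rewrite ffunE eqxx.
have fP v : v != r -> e v (f v) && (dist (f v) < dist v).
  move=> vr; rewrite ffunE (negPf vr); case: pickP => //= no.
  by have [u] := closer _ vr; rewrite no.
exists f; apply/andP; split; last first.
  by apply/forallP=> v; apply/implyP => /fP/andP[].
apply: forestP => v; rewrite inE.
- by move/eqP->.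
- by move=> /fP/andP[/e_proper -> _]; rewrite negbK.
move=> _; exists r; rewrite ?set11 //.
have [n] := ubnP (dist v); elim: n v => // n IHn v vn.
have [->|vr] := eqVneq v r; first exact: connect0.
rewrite fconnect_step IHn ?orbT //; have /andP[_ lt] := fP _ vr.
exact: leq_trans lt vn.
Qed.

(* A spanning tree of maximal total depth is normal: if an edge joined
   incomparable [u] and [v], rehanging the shallower endpoint below the other
   one would increase the total depth. *)
Lemma exists_normal : exists f, normal f.
Proof.
have [f0 sf0] := exists_spanning.
case: (@arg_maxnP _ f0 spanning (fun f => \sum_v order f v) sf0) => f sf fmax.
exists f; rewrite /normal sf; apply/forallP=> u; apply/forallP=> v.
apply/implyP=> euv; apply/negPn/negP; rewrite negb_or => /andP[uv vu].
wlog le_vu : u v euv uv vu / order f v <= order f u.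
  move=> W; case: (leqP (order f v) (order f u)) => [|/ltnW]; first exact: W.
  by apply: W; rewrite // e_sym.
have /andP[ff /forallP fe] := sf.
have fr : f r = r by apply: forest_root ff (set11 r).
have conn w : fconnect f w r.
  by have [s /set1P->] := forest_reach w ff.
have vr : v != r by apply: contraNneq uv => ->.
pose g := [ffun w => if w == v then u else f w].
have gv : g v = u by rewrite ffunE eqxx.
have gE w : w != v -> g w = f w by rewrite ffunE => /negPf->.
have sg : spanning g.
  apply/andP; split; last first.
    apply/forallP=> w; have := fe w; have [-> _|/gE->//] := eqVneq w v.
    by rewrite gv e_sym euv implybT.
  apply: forestP => w; rewrite inE.
  - by move/eqP->; rewrite gE // eq_sym.
  - have [-> _|wv wr] := eqVneq w v; first by rewrite gv (e_proper euv).
    by rewrite (gE _ wv) (forest_color ff) // inE.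
  move=> _; exists r; rewrite ?set11 //.
  have [wv|wv] := boolP (fconnect f w v); last by rewrite (fconnect_cut gE).
  apply: connect_trans (fconnect_cutr gE wv) _.
  by rewrite fconnect_step gv (fconnect_cut gE) // conn orbT.
have /andP[gf _] := sg.
have ltv : order f v < order g v.
  rewrite (order_step gf (v := v)) ?inE // gv ltnS.
  (* The path from [u] to the root avoids [v], so it survives; [v] now hangs one level below [u],
     which was at least as deep. *)
  suff -> : order g u = order f u by [].
  by apply: eq_card => w; rewrite !inE (fconnect_cut gE).
(* Other vertices keep their parents, so no depth decreases. *)
have lew w : order f w <= order g w.
  move: w; apply: (forest_ind ff) => [s /set1P->|w wr IHw].
    by rewrite order_root // -orderSpred.
  have [->|wv] := eqVneq w v; first exact: ltnW.
  by rewrite (order_step ff wr) (order_step gf wr) gE.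
have := fmax g sg; rewrite /= leqNgt => /negP; apply.
by rewrite (bigD1 v) //= [X in _ < X](bigD1 v) //= -addSn leq_add // leq_sum.
Qed.

(** Pairs go from a vertex to a proper ancestor, so an edge between comparable vertices is counted
    once although [e] is symmetric. *)
Definition up_pairs f : {set V * V} := [set p | (p.1 != p.2) && fconnect f p.1 p.2].
Definition up_edges f := [set p in up_pairs f | e p.1 p.2].
Definition extra_edges f := [set p in up_edges f | p.2 != f p.1].

Lemma card_up_pairs f : #|up_pairs f| = \sum_v (order f v).-1.
Proof.
rewrite -sum1_card (eq_bigl (fun p : V * V => true && ((p.1 != p.2) && fconnect f p.1 p.2)));
  last by move=> p; rewrite inE.
rewrite -(pair_big_dep xpredT (fun v u => (v != u) && fconnect f v u) (fun _ _ => 1)) /=.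
apply: eq_bigr => v _; rewrite sum1_card /order (cardD1 v (fconnect f v)) inE connect0 /=.
by apply: eq_card => w; rewrite !inE eq_sym.
Qed.

Lemma tree_edges f : spanning f ->
  up_edges f :\: extra_edges f = [set (v, f v) | v in [set~ r]].
Proof.
case/andP=> ff /forallP fe; apply/setP=> -[v w].
rewrite !inE /=; set up := (_ && _ && e v w).
have -> : ~~ (up && (w != f v)) && up = up && (w == f v).
  by case: up; rewrite //= andbT negbK.
apply/idP/imsetP => [/andP[/andP[/andP[vw _] _] /eqP wv]|[u]].
  exists v; rewrite ?wv // !inE.
  by apply: contraNneq vw => vr; rewrite wv vr (forest_root ff) ?set11.
rewrite /up {up}!inE => ur [-> ->]; rewrite eqxx andbT fconnect1 andbT.
have uS : u \notin [set r] by rewrite inE.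
rewrite (implyP (fe u) ur) andbT; have := forest_color ff uS.
by apply: contra_eqN => /eqP<-; case: (kappa u).
Qed.

Lemma card_extra f : spanning f -> #|up_edges f| = #|extra_edges f| + #|V|.-1.
Proof.
move=> sf; rewrite -(cardsID (extra_edges f)) tree_edges // card_imset; last by move=> u v [].
rewrite (finset.setIidPr _); last by apply/fintype.subsetP=> p; rewrite inE => /andP[].
by rewrite cardsC1.
Qed.
End NormalTree.

(** By [tree_edges], the remaining upward edges depend on [f] alone. *)
Lemma up_edges_inj (V : finType) (kappa : V -> bool) (r : V) (e e' : rel V) f :
  spanning kappa r e f -> spanning kappa r e' f ->
  extra_edges e f = extra_edges e' f -> up_edges e f = up_edges e' f.
Proof.
move=> sf sf' ee.
have sub (e1 : rel V) : extra_edges e1 f \subset up_edges e1 f.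
  by apply/fintype.subsetP=> p; rewrite inE => /andP[].
rewrite -(finset.setID (up_edges e f) (extra_edges e f)) (tree_edges sf).
rewrite -(finset.setID (up_edges e' f) (extra_edges e' f)) (tree_edges sf').
by rewrite (finset.setIidPr (sub _)) (finset.setIidPr (sub _)) ee.
Qed.

(** * Encoding connected bipartite graphs by normal trees *)

Section Bipartite.
Variables i j : nat.
Local Notation V := ('I_i + 'I_j)%type.
Definition side (x : V) := if x is inl _ then true else false.
Implicit Types (E : {set 'I_i * 'I_j}) (f : {ffun V -> V}).

Lemma bip_adj_sym E : symmetric (bip_adj E).
Proof. by case=> [a|b] [a'|b']. Qed.

Lemma bip_adj_side E u v : bip_adj E u v -> side u = ~~ side v.
Proof. by case: u v => [a|b] [a'|b']. Qed.

Lemma card_up_edges E r f : normal side r (bip_adj E) f ->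
  #|up_edges (bip_adj E) f| = #|E|.
Proof.
case/andP=> /andP[ff _] /forallP nf.
pose h (p : 'I_i * 'I_j) : V * V := if fconnect f (inl p.1) (inr p.2)
  then (inl p.1, inr p.2) else (inr p.2, inl p.1).
have h_inj : injective h.
  by move=> [a b] [a' b']; rewrite /h /=; do 2 case: ifP => _; move=> // [-> ->].
rewrite -(card_imset _ h_inj); apply: eq_card => -[u v].
apply/idP/imsetP => [|[[a b] ab ->]].
  rewrite !inE /=; case: u v => [a|b] [a'|b'] //=; rewrite ?andbF //.
    by move=> /andP[ab abE]; exists (a, b'); rewrite // /h /= ab.
  move=> /andP[ba abE]; exists (a', b); rewrite // /h /= ifN //.
  by apply/negP => /(forest_anti ff)/(_ ba).
rewrite /h /=; have /forallP/(_ (inr b))/implyP/(_ ab) := nf (inl a).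
by case: ifP => /= abf; rewrite !inE /= ?abf // => ->.
Qed.

(** A graph is coded by a normal tree and its non-tree edges. These form a subset of the ancestor
    pairs, whose number is the sum of the depths, of size [(i + j + l) - (i + j - 1) = l + 1]. *)
Lemma C_le_sum (l : nat) (r : V) :
  C i j l%:Z <= \sum_(f | forest side [set r] f) 'C(\sum_v (order f v).-1, l.+1).
Proof.
pose tree E := odflt [ffun v => v] [pick f | normal side r (bip_adj E) f].
have treeP E : bip_connected E -> normal side r (bip_adj E) (tree E).
  move=> /forallP Ec; rewrite /tree; case: pickP => //= no.
  have [|f] := exists_normal (@bip_adj_sym E) (@bip_adj_side E) (r := r).
    by move=> v; have /forallP := Ec v.
  by rewrite no.
pose code E := (tree E, extra_edges (bip_adj E) (tree E)).
pose codes := [set p : {ffun V -> V} * {set V * V} |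
  forest side [set r] p.1 && ((p.2 \subset up_pairs p.1) && (#|p.2| == l.+1))].
have <- : #|codes| = \sum_(f | forest side [set r] f) 'C(\sum_v (order f v).-1, l.+1).
  rewrite -sum1_card (eq_bigl _ _ (fun p => finset.in_set _ p)).
  rewrite -(pair_big_dep (fun f => forest side [set r] f)
    (fun f (D : {set V * V}) => (D \subset up_pairs f) && (#|D| == l.+1)) (fun _ _ => 1)) /=.
  apply: eq_bigr => f _; rewrite -card_up_pairs -cards_draws sum1_card.
  by apply: eq_card => D; rewrite !inE.
rewrite /C -(card_in_imset (f := code)).
  apply/subset_leq_card/fintype.subsetP => _ /imsetP[E + ->].
  rewrite !inE => /andP[/treeP nf /eqP cE]; have /andP[sf _] := nf.
  have /andP[-> _] := sf; rewrite /=; apply/andP; split.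
    by apply/fintype.subsetP => p; rewrite inE => /andP[]; rewrite inE => /andP[].
  have := card_extra sf; rewrite (card_up_edges nf).
  have : 0 < #|{: V}| by apply/card_gt0P; exists r.
  move: cE; rewrite card_sum !card_ord -!PoszD => -[->].
  by case: (i + j) => // n _ /= /eqP; rewrite addSnnS addnC eqn_add2r eq_sym.
move=> E E'; rewrite !inE => /andP[/treeP nf _] /andP[/treeP nf' _] [ff ee].
rewrite -ff in nf' ee; have [sf _] := andP nf; have [sf' _] := andP nf'.
have ue := up_edges_inj sf sf' ee; move: nf nf'.
move=> /andP[/andP[fo _] /forallP n1] /andP[_ /forallP n2].
(* By normality every edge appears as an upward pair, so the upward edges determine the graph. *)
have sub (E1 E2 : {set 'I_i * 'I_j}) (g : {ffun V -> V}) :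
  (forall u, [forall v, bip_adj E1 u v ==> fconnect g u v || fconnect g v u]) ->
  up_edges (bip_adj E1) g = up_edges (bip_adj E2) g -> E1 \subset E2.
  move=> n uE; apply/fintype.subsetP=> -[a b] ab.
  have /forallP/(_ (inr b))/implyP/(_ ab)/orP[] := n (inl a) => g1.
    by have : (inl a, inr b) \in up_edges (bip_adj E1) g;
      [rewrite !inE /= g1 | rewrite uE !inE /= => /andP[]].
  by have : (inr b, inl a) \in up_edges (bip_adj E1) g;
    [rewrite !inE /= g1 | rewrite uE !inE /= => /andP[]].
by apply/eqP; rewrite finset.eqEsubset (sub _ _ _ n1 ue) (sub _ _ _ n2 (esym ue)).
Qed.
End Bipartite.

Local Open Scope ring_scope.

(** * Estimates *)

Section Estimates.
Variable R : realType.

(** Each factor satisfies [p - t = p * (1 - t / p) <= p * expR (- t / p)], and the exponents sum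
    over [t < e]. *)
Lemma ffact_le_expR (p e : nat) : (0 < p)%N ->
  (p ^_ e)%:R <= p%:R ^+ e * expR (- (e * e.-1)%:R / (2 * p%:R)) :> R.
Proof.
move=> p0; have p0' : 0 < p%:R :> R by rewrite ltr0n.
elim: e => [|e IHe]; first by rewrite ffactn0 mul0n oppr0 mul0r expR0 mulr1.
rewrite ffactnSr natrM exprSr.
have -> : - (e.+1 * e.+1.-1)%:R / (2 * p%:R) =
    - (e * e.-1)%:R / (2 * p%:R) + - e%:R / p%:R :> R.
  case: e {IHe} => [|e] /=; rewrite ?mul0n ?muln0 ?mulr0n ?oppr0 ?mul0r ?addr0 //.
  by rewrite !natrM -[in LHS](addn1 e.+1) -!(addn1 e) !natrD; field; lra.
rewrite expRD mulrACA; apply: ler_pM => //.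
have [ep|pe] := leqP e p; last first.
  by have /eqP-> := ltnW pe; rewrite mulr_ge0 ?expR_ge0 // ltW.
apply: le_trans (_ : _ <= p%:R * (1 + - e%:R / p%:R)) _.
  by rewrite natrB // mulrDr mulr1 mulrCA divff ?mulr1 // lt0r_neq0.
by rewrite ler_pM2l // expR_ge1Dx.
Qed.

Lemma leq_ffact (p m e : nat) : (p <= m)%N -> (p ^_ e <= m ^_ e)%N.
Proof.
by move=> pm; elim: e => // e IHe; rewrite !ffactnSr leq_mul // leq_sub2r.
Qed.

Lemma deep_count_le (e p q n m : nat) :
  (0 < n)%N -> (0 < m)%N -> (p <= m)%N -> (q <= n)%N ->
  (deep_count e.*2 p q n m)%:R <=
  (n ^ p * m ^ q)%:R * expR (- (2 * (e * e.-1)%:R) / (m + n)%:R) :> R.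
Proof.
move=> n0 m0 pm qn; rewrite deep_count_double.
have := ffact_le_expR e n0; have := ffact_le_expR e m0.
move: (e * e.-1)%N => d fm fn.
have [pe|ep] := ltnP p e; first by rewrite ffact_small // mulr_ge0 ?expR_ge0 ?ler0n.
have [qe|eq] := ltnP q e.
  by rewrite (ffact_small qe) muln0 mulr_ge0 ?expR_ge0 ?ler0n.
have m0' : 0 < m%:R :> R by rewrite ltr0n.
have n0' : 0 < n%:R :> R by rewrite ltr0n.
apply: (@le_trans _ _ ((m%:R ^+ e * expR (- d%:R / (2 * m%:R)))
  * (n%:R ^+ e * expR (- d%:R / (2 * n%:R))) * (n ^ (p - e))%:R * (m ^ (q - e))%:R)).
  rewrite !natrM; do 2![apply: ler_pM; rewrite ?mulr_ge0 ?ler0n //].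
  apply: ler_pM; rewrite ?ler0n //.
    by apply: le_trans fm; rewrite ler_nat leq_ffact.
  by apply: le_trans fn; rewrite ler_nat leq_ffact.
rewrite natrM !natrX -[in leRHS](subnKC ep) -[in leRHS](subnKC eq) !exprD.
rewrite [leLHS](_ : _ = n%:R ^+ e * n%:R ^+ (p - e) * (m%:R ^+ e * m%:R ^+ (q - e)) *
  (expR (- d%:R / (2 * m%:R)) * expR (- d%:R / (2 * n%:R)))); last by ring.
rewrite ler_wpM2l ?mulr_ge0 ?exprn_ge0 ?ler0n // -expRD ler_expR.
rewrite !mulNr -opprD lerN2 natrD -subr_ge0.
(* This is [1 / m + 1 / n >= 4 / (m + n)], with the defect written as a square. *)
rewrite (_ : _ - _ = d%:R * (m%:R - n%:R) ^+ 2 / (2 * m%:R * n%:R * (m%:R + n%:R))); last first.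
  by field; rewrite ?lt0r_neq0 ?addr_gt0.
by rewrite divr_ge0 // mulr_ge0 ?sqr_ge0 // ?mulr_ge0 ?addr_ge0 ?ler0n.
Qed.

(* Abel summation; the summand [(w e.+1 - w e) / w e.+1 ^+ 2] is at most
   [1 / w e - 1 / w e.+1], which telescopes. *)
Lemma sum_weight_le (T : finType) (X : {set T}) (h : T -> nat) (w : nat -> R) (B : R) :
  w 0%N = 1 -> (forall e, w e <= w e.+1) ->
  (forall e, #|[set x in X | (e <= h x)%N]|%:R <= B / w e ^+ 2) ->
  \sum_(x in X) w (h x) <= 2 * B.
Proof.
move=> w0 wS tail.
have w1 e : 1 <= w e by elim: e => [|e IHe]; [rewrite w0|apply: le_trans (wS e)].
have wp e : 0 < w e by apply: lt_le_trans (w1 e).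
have B0 : 0 <= B by have := tail 0%N; rewrite w0 expr1n divr1; apply: le_trans.
pose M := \max_x h x.
have split x : w (h x) = 1 + \sum_(0 <= e < M) (if (e < h x)%N then w e.+1 - w e else 0).
  rewrite -big_mkcond -(big_nat_widen 0 (h x) M xpredT) ?leq_bigmax //=.
  by rewrite telescope_sumr // w0 subrKC.
rewrite (eq_bigr _ (fun x _ => split x)) big_split /= exchange_big /= sumr_const.
(* One [B] bounds the number of elements of [X], the other the telescoping sum. *)
rewrite (_ : 2 * B = B + B); last by ring.
apply: lerD.
  have := tail 0%N; rewrite w0 expr1n divr1; apply: le_trans.
  by rewrite ler_nat subset_leq_card //; apply/fintype.subsetP=> x xX; rewrite inE xX.
apply: (@le_trans _ _ (\sum_(0 <= e < M) B * ((w e)^-1 - (w e.+1)^-1))).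
  apply: ler_sum => e _; rewrite -big_mkcondr sumr_const.
  rewrite (eq_card (B := [set x in X | (e < h x)%N])); last by move=> x; rewrite !inE.
  rewrite -mulr_natl.
  apply: (@le_trans _ _ (B / w e.+1 ^+ 2 * (w e.+1 - w e))).
    by rewrite ler_wpM2r ?subr_ge0 // tail.
  rewrite -mulrA ler_wpM2l // -subr_ge0.
  rewrite (_ : _ - _ = (w e.+1 - w e) ^+ 2 / (w e * w e.+1 ^+ 2)); last first.
    by field; rewrite ?lt0r_neq0.
  by rewrite divr_ge0 ?mulr_ge0 ?exprn_ge0 ?subr_ge0 // ltW.
rewrite -mulr_sumr -[leRHS]mulr1 ler_wpM2l //.
rewrite (eq_bigr (fun e => (- (w e.+1)^-1) - (- (w e)^-1))); last first.
  by move=> e _; rewrite opprK addrC.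
rewrite telescope_sumr // w0 invr1 opprK.
by rewrite gerDr oppr_le0 invr_ge0 ltW.
Qed.

(** The left side is one term of the expansion of [(1 + x) ^+ a]. *)
Lemma bin_le_expR (a k : nat) (x : R) : 0 <= x -> 'C(a, k)%:R * x ^+ k <= expR (x * a%:R).
Proof.
move=> x0; have [ka|ak] := leqP k a; last by rewrite bin_small // mul0r expR_ge0.
rewrite expRM_natr; apply: (@le_trans _ _ ((1 + x) ^+ a)); last first.
  by rewrite lerXn2r ?nnegrE ?expR_ge0 ?addr_ge0 // expR_ge1Dx.
rewrite exprDn (bigD1 (inord k)) //= inordK // expr1n mul1r mulr_natl lerDl.
by apply: sumr_ge0 => i _; rewrite mulrn_wge0 // mulr_ge0 ?exprn_ge0.
Qed.

(** Jensen's inequality: sum the tangent bounds at [a], whose linear terms cancel. *)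
Lemma expR_sum_le_mean (T : finType) (y : T -> R) :
  #|T|%:R * expR (\sum_t y t) <= \sum_t expR (#|T|%:R * y t).
Proof.
set a := \sum_t y t.
have tangent t : expR a * (1 + (#|T|%:R * y t - a)) <= expR (#|T|%:R * y t).
  by rewrite -[X in _ <= expR X](subrKC a) expRD ler_wpM2l ?expR_ge0 // expR_ge1Dx.
apply: le_trans (ler_sum _ (fun t _ => tangent t)).
rewrite -mulr_sumr !big_split /= sumrN -mulr_sumr -/a !sumr_const.
by rewrite -[a *+ _]mulr_natl subrr addr0 mulrC.
Qed.
End Estimates.

(** * Exponential moments of the depth over all rooted trees *)

Section ForestSum.
Variables (R : realType) (V : finType) (kappa : V -> bool) (r : V).
Let n := #|color_class kappa (kappa r)|.
Let m := #|color_class kappa (~~ kappa r)|.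
Hypothesis m_gt0 : (0 < m)%N.

Let trees : {set {ffun V -> V} * V} := [set p | forest kappa [set r] p.1].
Let half_depth (p : {ffun V -> V} * V) := (order p.1 p.2).-1./2.
(** The number of spanning trees of the complete bipartite graph with classes of sizes [n] and
    [m]. *)
Let N0 := (n ^ m.-1 * m ^ n.-1)%N.

Let n_gt0 : (0 < n)%N.
Proof. by apply/card_gt0P; exists r; rewrite inE. Qed.

Let card_V : #|V| = (n + m)%N.
Proof.
rewrite -(cardC (mem (color_class kappa (kappa r)))); congr addn.
by apply: eq_card => v; rewrite !inE; case: (kappa v) (kappa r) => [] [].
Qed.

(** Even and odd depths contribute [n * N0] and [m * N0] times the same Gaussian factor, and [n + m]
    is [#|V|]. *)
Lemma depth_tail (e : nat) :
  #|[set p in trees | (e <= half_depth p)%N]|%:R <=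
  (N0 * #|V|)%:R / expR ((e * e.-1)%:R / #|V|%:R) ^+ 2 :> R.
Proof.
have En : #|color_class kappa (kappa r) :\: [set r]| = n.-1.
  by rewrite /n [in RHS](cardsD1 r) inE eqxx.
have Em : #|color_class kappa (~~ kappa r) :\: [set r]| = m.
  by rewrite /m [RHS](cardsD1 r) inE; case: (kappa r).
have deepE d : (#|deep kappa [set r] r d| <= deep_count d m n.-1 n m)%N.
  by have := card_deep kappa d (set11 r); rewrite En Em.
have -> : (N0 * #|V|)%:R / expR ((e * e.-1)%:R / #|V|%:R) ^+ 2 =
  (n ^ m * m ^ n.-1)%:R * expR (- (2 * (e * e.-1)%:R) / (m + n)%:R) +
  m%:R * ((m ^ n.-1 * n ^ m.-1)%:R * expR (- (2 * (e * e.-1)%:R) / (n + m)%:R)) :> R.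
  rewrite -expRM_natl -expRN card_V [(m + n)%N]addnC mulrA -mulrDl -natrM -natrD.
  congr (_%:R * expR _); last by rewrite mulrA mulNr.
  have -> : (n ^ m = n * n ^ m.-1)%N by rewrite -expnS prednK.
  by rewrite /N0; ring.
apply: (@le_trans _ _ (deep_count e.*2 m n.-1 n m + m * deep_count e.*2 n.-1 m.-1 m n)%:R).
  rewrite ler_nat -[(m * _)%N]/(deep_count e.*2.+1 m n.-1 n m).
  apply: leq_trans (leq_add (deepE _) (deepE _)).
  apply: leq_trans (card_depth_ge kappa r e).
  by apply/subset_leq_card/fintype.subsetP=> p; rewrite !inE.
rewrite natrD natrM; apply: lerD; first by rewrite deep_count_le // leq_pred.
by rewrite ler_wpM2l // deep_count_le // leq_pred.
Qed.

Lemma sum_expR_depth :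
  \sum_(p in trees) expR ((half_depth p * (half_depth p).-1)%:R / #|V|%:R)
  <= 2 * (N0 * #|V|)%:R :> R.
Proof.
apply: (sum_weight_le (w := fun e => expR ((e * e.-1)%:R / #|V|%:R))).
- by rewrite mul0n mul0r expR0.
- move=> e; rewrite ler_expR ler_wpM2r ?invr_ge0 // ler_nat.
  by case: e => // e; rewrite leq_mul.
- exact: depth_tail.
Qed.

(** The binomial is at most an exponential of the total depth, hence at most a mean of exponentials
    of single depths. A depth is at most [2 * h + 1] with [h] its half, so [hK] compares each with
    the summable weight. *)
Lemma sum_forest_bin (k : nat) (x K : R) : 0 <= x ->
  (forall h : nat,
    expR (#|V|%:R * x * (2 * h%:R + 1)) <= K * expR ((h * h.-1)%:R / #|V|%:R)) ->
  (\sum_(f | forest kappa [set r] f) 'C(\sum_v (order f v).-1, k))%:R * x ^+ k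
  <= 2 * N0%:R * K.
Proof.
move=> x0 hK.
have V0 : 0 < #|V|%:R :> R by rewrite ltr0n card_V addn_gt0 n_gt0.
rewrite -(ler_pM2l V0) natr_sum mulr_suml mulr_sumr.
apply: (@le_trans _ _ (\sum_(f | forest kappa [set r] f) \sum_v
    expR (#|V|%:R * (x * (order f v).-1%:R)))).
  apply: ler_sum => f _; apply: le_trans (expR_sum_le_mean _).
  by rewrite ler_wpM2l // -mulr_sumr -natr_sum bin_le_expR.
rewrite pair_big_dep /= (eq_bigl (mem trees)) => [|p]; last by rewrite !inE andbT.
apply: (@le_trans _ _ (\sum_(p in trees)
  K * expR ((half_depth p * (half_depth p).-1)%:R / #|V|%:R))).
  apply: ler_sum => -[f v] _; apply: le_trans (hK _).
  rewrite ler_expR mulrA ler_wpM2l ?mulr_ge0 //.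
  rewrite -[_.-1](odd_double_half (order f v).-1) natrD -muln2 natrM mulrC addrC.
  by rewrite lerD2l lern1; case: odd.
have K0 : 0 <= K.
  have := hK 0%N; rewrite mul0n mul0r expR0 mulr1; apply: le_trans; exact: expR_ge0.
rewrite -mulr_sumr; apply: le_trans (ler_wpM2l K0 sum_expR_depth) _.
by rewrite natrM le_eqVlt; apply/orP; left; apply/eqP; ring.
Qed.
End ForestSum.

(** * Choice of parameters and final bound *)

(** Completing the square in [h] leaves [k + 2 * y + 1 / 4]; then [2 * y <= y ^+ 2 + 1 <= k + 1] and
    [k >= 1]. *)
Lemma weight_exponent_le (R : realFieldType) (N y k : R) (h : nat) :
  1 <= N -> 1 <= k -> y ^+ 2 * N = k ->
  y * (2 * h%:R + 1) <= 4 * k + (h * h.-1)%:R / N.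
Proof.
move=> N1 k1 yk; have N0 : 0 < N by apply: lt_le_trans N1.
have -> : (h * h.-1)%:R = h%:R ^+ 2 - h%:R :> R.
  by case: h => [|h]; rewrite ?mul0n ?expr0n ?subrr //= natrM -addn1 natrD; ring.
have y2 : y ^+ 2 <= k by rewrite -yk ler_peMr ?sqr_ge0.
have sq : 0 <= (h%:R - 1 / 2 - y * N) ^+ 2 / N by rewrite divr_ge0 ?sqr_ge0 ?ltW.
have E : (h%:R - 1 / 2 - y * N) ^+ 2 / N =
  (h%:R ^+ 2 - h%:R) / N + 1 / 4 * N^-1 + y ^+ 2 * N - 2 * h%:R * y + y.
  by field; apply: lt0r_neq0.
have iN : N^-1 <= 1 by rewrite invf_le1.
have sq1 : 0 <= (y - 1) ^+ 2 by apply: sqr_ge0.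
move: sq; rewrite E yk; nra.
Qed.

Lemma color_class_side (i j : nat) (b : bool) :
  #|color_class (@side i j) b| = if b then i else j.
Proof.
case: b.
  rewrite -[RHS]card_ord -(card_imset predT (@inl_inj 'I_i 'I_j)).
  apply: eq_card => -[a|a]; rewrite inE /=; apply/esym; first by rewrite imset_f.
  by apply/negP => /imsetP[].
rewrite -[RHS]card_ord -(card_imset predT (@inr_inj 'I_i 'I_j)).
apply: eq_card => -[a|a]; rewrite inE /=; apply/esym; last by rewrite imset_f.
by apply/negP => /imsetP[].
Qed.

Lemma C_mul_le (R : realType) (i j l : nat) (x : R) : (0 < i)%N -> (0 < j)%N ->
  0 <= x -> ((i + j)%:R * x) ^+ 2 * (i + j)%:R = l.+1%:R ->
  (C i j l%:Z)%:R * x ^+ l.+1 <=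
  2 * (i ^ j.-1 * j ^ i.-1)%:R * expR (4 * l.+1%:R) :> R.
Proof.
move=> i0 j0 x0 xl; pose r : 'I_i + 'I_j := inr (Ordinal j0).
apply: (@le_trans _ _ ((\sum_(f | forest (@side i j) [set r] f)
    'C(\sum_v (order f v).-1, l.+1))%:R * x ^+ l.+1)).
  by rewrite ler_wpM2r ?exprn_ge0 // ler_nat C_le_sum.
have := @sum_forest_bin R _ (@side i j) r _ l.+1 x (expR (4 * l.+1%:R)).
rewrite !color_class_side card_sum !card_ord /= mulnC; apply => // h.
by rewrite -expRD ler_expR weight_exponent_le ?ler1n // addn_gt0 i0.
Qed.

Theorem theorem3p5 (R : realType) :
  exists c : R, 0 < c /\
    forall i j l : nat,
      (0 < i)%N -> (0 < j)%N -> (0 < l)%N ->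
      l%:Z <= i%:Z * j%:Z - i%:Z - j%:Z ->
      1 / 2 <= i%:R / j%:R :> R -> i%:R / j%:R <= 2 :> R ->
      (C i j l%:Z)%:R <=
        i%:R ^+ j * j%:R ^+ i
        * (i + j)%:R `^ ((3 * l%:R - 1) / 2)
        * (c / l%:R) `^ (l%:R / 2).
Proof.
(* The power [l / 2] of this constant is [expR (12 * l)], which must absorb
   [9 * expR (4 * (l + 1))]. *)
exists (expR 24); split=> [|i j l i0 j0 l0 _]; first exact: expR_gt0.
have i0' : 0 < i%:R :> R by rewrite ltr0n.
have j0' : 0 < j%:R :> R by rewrite ltr0n.
have l0' : 0 < l%:R :> R by rewrite ltr0n.
rewrite ler_pdivlMr // => ji; rewrite ler_pdivrMr // => ij.
set N : R := (i + j)%:R; have N0 : 0 < N by rewrite ltr0n addn_gt0 i0.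
(* This is the square root of [(l + 1) / N ^+ 3], written so that real powers become linear in
   logarithms. *)
pose x := expR ((ln l.+1%:R - 3 * ln N) / 2).
have x0 : 0 < x by apply: expR_gt0.
have xl : (N * x) ^+ 2 * N = l.+1%:R.
  rewrite -[N in N * x]lnK // -[N in _ * N]lnK // -expRD -expRM_natl -expRD.
  by rewrite -[RHS]lnK ?posrE ?ltr0n //; congr expR; field.
rewrite -(ler_pM2r (exprn_gt0 l.+1 x0)).
apply: le_trans (C_mul_le i0 j0 (ltW x0) xl) _.
rewrite -!mulrA; set T := (X in _ <= _ * (_ * X)).
(* The exponents of [N] add up to [(3 * l - 1) / 2 - 3 * (l + 1) / 2 = - 2]. *)
have -> : T = expR (12 * l%:R - 2 * ln N + (l.+1%:R * ln l.+1%:R - l%:R * ln l%:R) / 2).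
  rewrite /T /powR !gt_eqF ?divr_gt0 ?expR_gt0 // -expRM_natl -!expRD.
  rewrite ln_div ?posrE ?expR_gt0 // expRK; congr expR.
  by rewrite -natr1; field.
have lnl : 0 <= (l.+1%:R * ln l.+1%:R - l%:R * ln l%:R) / 2 :> R.
  rewrite divr_ge0 // subr_ge0 ler_pM // ?ln_ge0 ?ler1n // ?ler_nat //.
  by rewrite ler_ln ?posrE ?ltr0n // ler_nat.
have {lnl} Tge : expR (12 * l%:R) / N ^+ 2 <= expR (12 * l%:R - 2 * ln N +
    (l.+1%:R * ln l.+1%:R - l%:R * ln l%:R) / 2).
  rewrite -[N in N ^+ 2]lnK // -expRM_natl -expRN -expRD ler_expR.
  by rewrite lerDl.
(* The factor [i * j] split off here pays for the lost [N ^+ 2]. *)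
have ijE : i%:R ^+ j * j%:R ^+ i = i%:R * j%:R * (i ^ j.-1 * j ^ i.-1)%:R :> R.
  by rewrite natrM !natrX mulrACA -!exprS !prednK.
rewrite [leRHS]mulrA ijE; apply: le_trans (ler_wpM2l _ Tge); last by rewrite !mulr_ge0 ?ler0n.
rewrite [leRHS]mulrA ler_pdivlMr ?exprn_gt0 // {Tge ijE}.
move: ((i ^ _ * _)%:R : R) (ler0n R (i ^ j.-1 * j ^ i.-1)) => A A0.
rewrite [leLHS](_ : _ = A * (2 * N ^+ 2 * expR (4 * l.+1%:R))); last by ring.
rewrite [leRHS](_ : _ = A * (i%:R * j%:R * expR (12 * l%:R))); last by ring.
rewrite ler_wpM2l //.
(* The difference of the two sides is [(2 * i - j) * (2 * j - i)], nonnegative by the bounds on the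
   ratio. *)
have NE : 2 * N ^+ 2 <= 9 * (i%:R * j%:R) by rewrite /N natrD; nra.
have eE : 9 * expR (4 * l.+1%:R) <= expR (12 * l%:R) :> R.
  have l1 : 1 <= l%:R :> R by rewrite ler1n.
  have e4 : 9 <= expR 4 :> R.
    have e2 : 3 <= expR 2 :> R by apply: le_trans (expR_ge1Dx 2); lra.
    have -> : 9 = 3 ^+ 2 :> R by ring.
    have -> : 4 = 2%:R * 2 :> R by ring.
    by rewrite expRM_natl lerXn2r ?nnegrE ?expR_ge0.
  apply: le_trans (ler_wpM2r (expR_ge0 _) e4) _.
  by rewrite -expRD ler_expR -natr1; lra.
apply: le_trans (ler_wpM2r (expR_ge0 _) NE) _.
by rewrite [9 * _]mulrC -[leLHS]mulrA ler_wpM2l // mulr_ge0 // ltW.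
Qed.
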